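(* Let $A$ and $B$ be nonempty closed subsets of $X$, let $c\in A\cap B$, and set $L:=\operatorname{aff}(A\cup B)$. Assume that $A$ and $B$ are $L$-superregular at $c$, and that $$N_A(c)\cap(-N_B(c))\cap(L-c)=\{0\}.$$ Then the sequences generated by the method of alternating projections with respect to $(A,B)$ converge linearly to a point in $A\cap B$ provided that the starting point is sufficiently close to $c$; that is, there exists $r>0$ such that for every $b_{-1}\in X$ with $\|b_{-1}-c\|\leq r$, any sequences $(a_n)_{n\in\mathbb N}$ and $(b_n)_{n\in\mathbb N}$ generated by the method of alternating projections with starting point $b_{-1}$ converge linearly to a point in $A\cap B$.
   Context: $X$ is a Euclidean space (finite-dimensional real Hilbert space) with inner product $\langle\cdot,\cdot\rangle$ and norm $\|\cdot\|$; $\mathbb N=\{0,1,2,\dots\}$. $\operatorname{aff}S$ is the smallest affine subspace containing $S$. For $S\subseteq X$ nonempty, $\operatorname{cone}(S)=\{\rho s:\rho\geq0,\,s\in S\}$, and $\operatorname{cone}(\varnothing)=\{0\}$. For nonempty $C\subseteq X$, $P_C(x)=\{y\in C:\|x-y\|=\inf_{z\in C}\|x-z\|\}$ (set-valued projection) and $P_C^{-1}(y)=\{x\in X: y\in P_C(x)\}$. For nonempty $C,D\subseteq X$ and $x\in C$, the $D$-restricted proximal normal cone is $\widehat N_C^{D}(x)=\operatorname{cone}((D\cap P_C^{-1}(x))-x)$. The Mordukhovich normal cone $N_C(x)$ at $x\in C$ is the set of all $u$ for which there exist $x_n\in C$ and $u_n\in\widehat N_C^X(x_n)=\operatorname{cone}(P_C^{-1}(x_n)-x_n)$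 with $x_n\to x$, $u_n\to u$. For nonempty $D,E\subseteq X$, $D$ is $E$-superregular at $c$ if for every $\varepsilon>0$ there exists $\delta>0$ such that $\langle u,y-b\rangle\leq\varepsilon\|u\|\,\|y-b\|$ whenever $y,b\in D$, $\|y-c\|\leq\delta$, $\|b-c\|\leq\delta$, $u\in\widehat N_D^{E}(b)$. Method of alternating projections for $(A,B)$ with starting point $b_{-1}\in X$: any sequences with $a_n\in P_A(b_{n-1})$ and $b_n\in P_B(a_n)$ for all $n\in\mathbb N$. A sequence $(x_n)$ converges linearly to $\bar x$ if there are $\gamma\in[0,1[$ and $\mu\geq0$ with $\|x_n-\bar x\|\leq\mu\gamma^n$ for all $n\in\mathbb N$. *)

(* Defs.v *)
From HB Require Import structures.
From mathcomp Require Import all_boot all_order all_algebra.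
From mathcomp Require Import all_classical all_reals all_analysis.

Set Implicit Arguments.
Unset Strict Implicit.
Unset Printing Implicit Defensive.

Import Order.TTheory GRing.Theory Num.Theory.
Import numFieldNormedType.Exports.
Local Open Scope classical_set_scope.
Local Open Scope ring_scope.

(* Finite-dimensional normed spaces. The topology is that of the norm; a
   Euclidean space is such an X together with a positive definite symmetric
   bilinear form that induces the norm, see [induces_norm]. *)
#[short(type="finNormedModType")]
HB.structure Definition FinNormedModule (R : realType) :=
  {X of NormedModule R X & Vector R X}.

Section Defs.
Variables (R : realType) (X : finNormedModType R).
Implicit Types (A B C D E S : set X) (x y c : X).

Definition induces_norm (dot : {dot X for idfun}) : Prop :=
  forall x, `|x| = Num.sqrt (dot x x).

Definition affine_subspace S : Prop :=
  S !=set0 /\ forall x y (t : R), S x -> S y -> S (t *: x + (1 - t) *: y).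

Definition aff S : set X := smallest affine_subspace S.

Definition cone S : set X :=
  if S == set0 then [set 0]
  else [set u | exists rho : R, exists2 s, 0 <= rho /\ S s & u = rho *: s].

Definition proj C x : set X :=
  [set y | C y /\ `|x - y| = inf [set `|x - z| | z in C]].

Definition proj_inv C y : set X := [set x | proj C x y].

(* The [D]-restricted proximal normal cone of [C] at [x]. *)
Definition prox_normal_cone D C x : set X :=
  cone [set z - x | z in D `&` proj_inv C x].

Definition mordukhovich_normal_cone C x : set X :=
  [set u | exists x_ u_ : nat -> X,
    [/\ forall n, C (x_ n),
        forall n, prox_normal_cone setT C (x_ n) (u_ n),
        x_ @ \oo --> x & u_ @ \oo --> u]].

(* [D] is [E]-superregular at [c]. *)
Definition superregular (dot : {dot X for idfun}) E D c : Prop :=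
  forall eps : R, 0 < eps -> exists2 delta : R, 0 < delta &
    forall y b u, D y -> D b -> `|y - c| <= delta -> `|b - c| <= delta ->
      prox_normal_cone E D b u -> dot u (y - b) <= eps * `|u| * `|y - b|.

(* [b0] is the starting point $b_{-1}$. *)
Definition alternating_projections A B (b0 : X) (a b : nat -> X) : Prop :=
  forall n, proj A (if n is m.+1 then b m else b0) (a n) /\ proj B (a n) (b n).

Definition converges_linearly (x_ : nat -> X) x : Prop :=
  exists gamma mu : R, [/\ 0 <= gamma < 1, 0 <= mu &
    forall n, `|x_ n - x| <= mu * gamma ^+ n].

End Defs.

(* Main.v *)
Require Import Defs.
From HB Require Import structures.
From mathcomp Require Import all_boot all_order all_algebra.
From mathcomp Require Import all_classical all_reals all_analysis.
From mathcomp Require Import lra ring.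

Import Order.TTheory GRing.Theory Num.Theory.
Import numFieldNormedType.Exports.
Local Open Scope classical_set_scope.
Local Open Scope ring_scope.

(** Write [L] for the affine hull of [A `|` B] and [d n] for the gap
    [`|b n - a n|]. The gaps shrink by a fixed factor as long as the iterates
    stay near [c], and shrinking gaps keep them near [c].

    Shrinking ([contraction_step]). The vector [u := b n - a n.+1] is an
    [L]-restricted proximal normal of [A] at [a n.+1], and [v := a n - b n] is
    one of [B] at [b n]. Split
    [`|u|^2 = dot u (b n - a n) + dot u (a n - a n.+1)]. The first summand is
    [dot u (- v)], and the qualification condition keeps [u] and [- v] from being
    nearly parallel, so it is at most [theta * `|u| * `|v|] for some
    [theta < 1]. The second summand is at most
    [eps * `|u| * `|a n - a n.+1| <= 2 * eps * `|u| * `|v|] by superregularity of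
    [A]. Dividing by [`|u|], the new distance is at most
    [(theta + 2 * eps) * d n], and projecting onto [B] does not increase it.

    The constant [theta] comes from compactness
    ([normals_uniformly_transversal]): if unit proximal normals at points
    arbitrarily close to [c] could be arbitrarily close to opposite, a cluster
    point of them would be a unit vector in [N_A(c)] and in [- N_B(c)]. All
    restricted normals lie in the direction space of [L], which is closed, so
    that vector would also lie in [L - c], against the hypothesis.

    Staying near [c] ([alternating_projections_contract]). One step moves the
    point of [A] by at most [2 * d n], and the remaining gaps are dominated by a
    geometric series, so the total displacement is at most a multiple of the
    initial gap, itself at most a multiple of the distance of the starting point
    to [c].

    The steps therefore have geometrically decreasing lengths, so both sequences
    converge linearly, to a common limit as the gaps vanish; it lies in both
    sets because they are closed. *)

(** * Compactness in finite dimension *)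

Lemma norm_normalized {R : realType} {V : normedModType R} (x : V) :
  x != 0 -> `| `|x|^-1 *: x | = 1.
Proof.
by move=> x0; rewrite normrZ ger0_norm ?invr_ge0// mulVf// normr_eq0.
Qed.

Lemma normalizedK {R : realType} {V : normedModType R} (x : V) :
  x != 0 -> `|x| *: (`|x|^-1 *: x) = x.
Proof. by move=> x0; rewrite scalerA divff ?scale1r// normr_eq0. Qed.

Section FiniteDimension.
Context {R : realType} {X : finNormedModType R}.

Definition lincomb {n} (e : n.-tuple X) (x : 'rV[R]_n) : X :=
  \sum_i x 0 i *: e`_i.

Lemma lincombZ {n} (e : n.-tuple X) a x : lincomb e (a *: x) = a *: lincomb e x.
Proof.
by rewrite /lincomb scaler_sumr; apply: eq_bigr => i _; rewrite mxE scalerA.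
Qed.

Lemma lincomb_continuous {n} (e : n.-tuple X) : continuous (lincomb e).
Proof.
move=> x; apply: (@cvg_big _ _ _ _ _ _ _ (nbhs x)) => [|i _].
  exact: add_continuous.
by apply: (@cvgZr_tmp R X _ (nbhs x)); exact: coord_continuous.
Qed.

Lemma lincomb_eq0 {n} (e : n.-tuple X) x : free e -> lincomb e x = 0 -> x = 0.
Proof. by move=> /freeP fe x0; apply/rowP => i; rewrite mxE (fe (x 0) x0). Qed.

(** All norms are equivalent in finite dimension: the continuous positive
    function [x |-> `|lincomb e x|] attains its minimum on the compact unit
    sphere of the coordinate space, and homogeneity does the rest. *)
Lemma lincomb_norm_ge {n} (e : n.-tuple X) : free e ->
  exists2 m, 0 < m & forall x, m * `|x| <= `|lincomb e x|.
Proof.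
move=> fe; pose S := [set x : 'rV[R]_n | `|x| = 1].
have cN : continuous (fun x => `|lincomb e x|).
  move=> x; apply: continuous_comp; [exact: lincomb_continuous|].
  exact: norm_continuous.
suff [m m0 mS] : exists2 m, 0 < m & forall x, S x -> m <= `|lincomb e x|.
  exists m => // x; have [->|x0] := eqVneq x 0.
    by rewrite normr0 mulr0.
  rewrite -[in leRHS](normalizedK _ x0) lincombZ normrZ normr_id mulrC.
  by rewrite ler_wpM2l// mS//; exact: norm_normalized.
(* The sphere is empty in dimension zero. *)
have [->|S0] := eqVneq S set0; first by exists 1.
have cS : compact S.
  apply: bounded_closed_compact.
    by exists 1; split => // M M1 x /= ->; exact: ltW.
  apply: (@preimage_closed _ _ (fun x : 'rV[R]_n => `|x|) [set 1]).
    by move=> x _; exact: norm_continuous.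
  exact: closed_eq.
have [c cS1 cmin] := compact_EVT_min ((set0P _).1 S0) cS (continuous_subspaceT cN).
exists `|lincomb e c|; last by move=> x Sx; apply: cmin; rewrite inE.
rewrite normr_gt0; apply/eqP => /(lincomb_eq0 _ _ fe) c0; move: cS1.
by rewrite inE /S /= c0 normr0 => /esym/eqP; rewrite oner_eq0.
Qed.

(** The ball is the continuous image of a set of coordinates, closed by
    continuity and bounded by the comparison of norms. Having it for a proper
    subspace also shows that limits of bounded sequences of [U] stay in [U]. *)
Lemma compact_vspace_ball (U : {vspace X}) (M : R) :
  compact [set u | u \in U /\ `|u| <= M].
Proof.
pose e := vbasis U.
have [m m0 me] := lincomb_norm_ge e (basis_free (vbasisP U)).
have cK : compact [set x | `|lincomb e x| <= M].
  apply: bounded_closed_compact.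
    exists (M / m); split => [|N /ltW MN x /= xM]; first exact: num_real.
    apply: le_trans MN; rewrite ler_pdivlMr// mulrC.
    exact: le_trans (me x) xM.
  apply: (@preimage_closed _ _ (fun x => `|lincomb e x|) [set y | y <= M]).
    move=> x _; apply: continuous_comp; [exact: lincomb_continuous|].
    exact: norm_continuous.
  exact: closed_le.
have := continuous_compact (continuous_subspaceT (lincomb_continuous e)) cK.
congr compact; apply/seteqP; split => [_ [x xM <-]|u [uU uM]].
  split => //; apply: memv_suml => i _; apply: memvZ.
  by apply: vbasis_mem; rewrite mem_nth// size_tuple.
have uE : lincomb e (\row_i coord e i u) = u.
  rewrite [RHS](coord_vbasis uU); apply: eq_bigr => i _.
  by rewrite mxE.
by exists (\row_i coord e i u); rewrite /= uE.
Qed.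

Lemma compact_cluster_seq {K : set X} {u : nat -> X} :
  compact K -> (forall n, K (u n)) ->
  exists2 p, K p & forall e N, 0 < e -> exists2 n, (N <= n)%N & `|u n - p| < e.
Proof.
move=> cK Ku; have [|p [Kp clp]] := cK (u @ \oo) _.
  by exists 0%N => // n _; exact: Ku.
exists p => // e N e0.
have [||] := clp [set u n | n in [set n | (N <= n)%N]] (ball p e).
- by exists N => // n Nn; exists n.
- exact: nbhsx_ballx.
by move=> _ [[n Nn <-]]; rewrite -ball_normE/= distrC; exists n.
Qed.

(** Take a subspace of maximal dimension among those contained in [V]: adjoining
    to it an element of [V] gives again a subspace contained in [V], so the
    element was already there. *)
Lemma vspace_of_linear_set (V : set X) : V 0 ->
  (forall (s t : R) x y, V x -> V y -> V (s *: x + t *: y)) ->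
  exists U : {vspace X}, forall x, V x <-> x \in U.
Proof.
move=> V0 Vlin.
pose P d := `[< exists2 U : {vspace X}, \dim U = d & forall x, x \in U -> V x >].
have P0 : exists d, P d.
  exists 0%N; apply/asboolP; exists 0%VS; first exact: dimv0.
  by move=> x; rewrite memv0 => /eqP ->.
have Pmax d : P d -> (d <= \dim {:X})%N.
  by move=> /asboolP[U <- _]; exact: dimvS (subvf U).
case: (ex_maxnP P0 Pmax) => d /asboolP[U dU UV] dmax.
exists U => x; split => [Vx|]; last exact: UV.
have /dmax : P (\dim (U + <[x]>)%VS).
  apply/asboolP; exists (U + <[x]>)%VS => // w /memv_addP[y /UV Vy [z]].
  by case/vlineP=> t -> ->; rewrite -[y]scale1r; exact: Vlin.
rewrite -dU => dimle.
have /eqP UE : U == (U + <[x]>)%VS by rewrite eqEdim addvSl.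
by rewrite UE; exact: subvP (addvSr U <[x]>%VS) x (memv_line x).
Qed.

End FiniteDimension.

(** * Limits of sequences *)

Section Sequences.
Context {R : realType} {X : finNormedModType R}.

Lemma cvg_harmonic_bound {x : nat -> X} {l : X} {M : R} : 0 < M ->
  (forall k, `|x k - l| <= M * k.+1%:R^-1) -> x @ \oo --> l.
Proof.
move=> M0 xl; apply/cvgrPdist_lt => e e0; near=> n.
rewrite distrC; apply: le_lt_trans (xl n) _.
rewrite mulrC -ltr_pdivlMr//; near: n.
exact: (near_infty_natSinv_lt (PosNum (divr_gt0 e0 M0))).
Unshelve. all: by end_near. Qed.

Lemma converges_linearly_cvg {x : nat -> X} {l : X} :
  converges_linearly x l -> x @ \oo --> l.
Proof.
move=> [g [mu [/andP[g0 g1] mu0 xl]]]; apply/cvgrPdist_lt => e e0.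
have gn : `|g| < 1 by rewrite ger0_norm.
have /cvgrPdist_lt/(_ e e0) := cvg_geometric mu gn.
apply: filterS => n; rewrite sub0r normrN distrC /geometric/=.
by apply: le_lt_trans; exact: le_trans (xl n) (ler_norm _).
Qed.

(** Telescoping bounds the tails by those of a geometric series; in particular
    the sequence is bounded, so it has a cluster point, to which the tail bounds
    pass. *)
Lemma geometric_steps_converge {x : nat -> X} {M g : R} : 0 <= M -> 0 <= g < 1 ->
  (forall n, `|x n.+1 - x n| <= M * g ^+ n) ->
  exists l, forall n, `|x n - l| <= M / (1 - g) * g ^+ n.
Proof.
move=> M0 /andP[g0 g1] xS; have g1' : 0 < 1 - g by rewrite subr_gt0.
have C0 : 0 <= M / (1 - g) by rewrite divr_ge0// ltW.
have tail n k :
    `|x (n + k)%N - x n| <= M / (1 - g) * g ^+ n * (1 - g ^+ k).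
  elim: k => [|k IHk]; first by rewrite addn0 !subrr normr0 mulr0.
  rewrite addnS; apply: le_trans (ler_distD (x (n + k)%N) _ _) _.
  apply: le_trans (lerD (xS _) IHk) _; rewrite exprD exprS.
  rewrite le_eqVlt; apply/orP; left; apply/eqP; field.
  by rewrite gt_eqF.
have {}tail n k : `|x (n + k)%N - x n| <= M / (1 - g) * g ^+ n.
  apply: le_trans (tail n k) _; rewrite ler_piMr//.
    by rewrite mulr_ge0// exprn_ge0.
  by rewrite gerBl exprn_ge0.
have [|l _ cl] := compact_cluster_seq
    (compact_vspace_ball fullv (`|x 0%N| + M / (1 - g))) (u := x).
  move=> n; split; first exact: memvf.
  have := tail 0%N n; rewrite expr0 mulr1 add0n => xn.
  by rewrite -[x n](subrK (x 0%N)) (le_trans (ler_normD _ _))// addrC lerD2l.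
exists l => n; apply/ler_addgt0Pr => e e0.
have [m nm xml] := cl e n e0.
apply: le_trans (ler_distD (x m) _ _) _; apply: lerD; last exact: ltW.
by rewrite distrC -(subnKC nm); exact: tail.
Qed.

End Sequences.

(** * Affine hulls, projections and restricted proximal normals *)

Section ProximalNormals.
Context {R : realType} {X : finNormedModType R}.
Implicit Types (A B C D E S L : set X) (a b c x y z u v : X).

Lemma sub_aff S : S `<=` aff S.
Proof. by move=> x Sx M [_]; exact. Qed.

Lemma aff_line S x y (t : R) :
  aff S x -> aff S y -> aff S (t *: x + (1 - t) *: y).
Proof.
move=> Sx Sy M MS; case: (MS) => -[_ + _]; apply; [exact: Sx|exact: Sy].
Qed.

(** Scaling by [t] about [c] is an affine combination with [c], and
    [c + (s *: x + t *: y)] is the midpoint of [c + (2 * s) *: x] and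
    [c + (2 * t) *: y], so the translate of [aff S] by [- c] is linear. *)
Lemma direction_of_aff S c : aff S c ->
  exists U : {vspace X}, forall x, aff S (c + x) <-> x \in U.
Proof.
move=> Sc; apply: (vspace_of_linear_set [set x | aff S (c + x)]) => /=.
  by rewrite addr0.
have scal (t : R) x : aff S (c + x) -> aff S (c + t *: x).
  move=> Sx; have := aff_line _ _ _ t Sx Sc.
  by rewrite scalerDr scalerBl scale1r addrC addrA subrK.
move=> s t x y /(scal (s *+ 2)) Sx /(scal (t *+ 2)) Sy.
have := aff_line _ _ _ 2^-1 Sx Sy.
rewrite (_ : 1 - 2^-1 = 2^-1 :> R); last by field.
rewrite !scalerDr !scalerA addrACA -scalerDl (_ : 2^-1 + 2^-1 = 1 :> R).
  by rewrite scale1r !mulrnAr -!mulrnAl -[_ *+ 2]mulr_natr mulVf ?mul1r.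
by field.
Qed.

Lemma proj_dist C x y z : Defs.proj C x y -> C z -> `|x - y| <= `|x - z|.
Proof.
move=> [_ ->] Cz; apply: ge_inf; last by exists z.
by exists 0 => _ [w _ <-].
Qed.

Lemma cone_scale S (t : R) u : 0 <= t -> cone S u -> cone S (t *: u).
Proof.
rewrite /cone => t0; case: ifPn => _ /=; first by move=> ->; rewrite scaler0.
move=> [rho [s [rho0 Ss] ->]]; exists (t * rho); exists s; rewrite ?scalerA//.
by rewrite mulr_ge0.
Qed.

Lemma coneS S T : S `<=` T -> cone S `<=` cone T.
Proof.
rewrite /cone => ST u; have [_ /= ->|S0 [rho [s [rho0 Ss] ->]]] := eqVneq S set0.
  (* The cone of the empty set is {0}, which is 0 times any point of T. *)
  by case: ifPn => //= /set0P[x Tx]; exists 0; exists x; rewrite ?scale0r//.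
have Ts := ST _ Ss; case: ifPn => [/eqP T0|_]; first by rewrite T0 in Ts.
by exists rho; exists s.
Qed.

Lemma prox_normal_coneS D E C x : D `<=` E ->
  prox_normal_cone D C x `<=` prox_normal_cone E C x.
Proof. by move=> DE; apply: coneS; apply: image_subset; exact: setSI. Qed.

Lemma prox_normal_proj D C x y : D x -> Defs.proj C x y ->
  prox_normal_cone D C y (x - y).
Proof.
move=> Dx Cxy; rewrite /prox_normal_cone /cone.
have Sxy : [set z - y | z in D `&` proj_inv C y] (x - y) by exists x.
case: ifPn => [/eqP S0|_]; first by rewrite S0 in Sxy.
by exists 1; exists (x - y); rewrite ?scale1r.
Qed.

(** A restricted normal is a multiple of the difference of two points of the
    affine hull. *)
Lemma prox_normal_direction S c (U : {vspace X}) C x :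
  (forall y, aff S (c + y) <-> y \in U) -> C `<=` aff S -> C x ->
  prox_normal_cone (aff S) C x `<=` [set u | u \in U].
Proof.
move=> SU CS Cx u; rewrite /prox_normal_cone /cone.
case: ifPn => _ /=; first by move=> ->; exact: mem0v.
move=> [rho [_ [_ [z [Sz _] <-]] ->]].
have inU w : aff S w -> w - c \in U by move=> Sw; apply/SU; rewrite addrC subrK.
apply: memvZ; rewrite -[z](subrK c) -[x](subrK c) opprD addrACA subrr addr0.
by apply: memvB; apply: inU => //; exact: CS.
Qed.

End ProximalNormals.

(** * Transversality of the normal cones *)

Section Transversality.
Context {R : realType} {X : finNormedModType R}.
Implicit Types (A B L : set X) (a b c u v : X).

(** If this failed for every [eta = 1 / (k + 1)], the counterexamples would be
    points of [A] and [B] tending to [c], with unit normals [u] and [v] such that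
    [u + v] tends to [0]. The vectors [u] lie in the unit ball of the direction
    space of the affine hull, which is compact; a cluster point [p] is nonzero
    and lies in that space, [p] is a limiting normal of [A] and [- p] one of [B],
    which the qualification condition excludes. The same [eta] serves as a
    radius around [c] and as a lower bound for [`|u + v|]. *)
Lemma normals_uniformly_transversal A B c : A c ->
  mordukhovich_normal_cone A c
    `&` [set - u | u in mordukhovich_normal_cone B c]
    `&` [set z - c | z in aff (A `|` B)] = [set 0] ->
  exists2 eta : R, 0 < eta <= 1 & forall a b u v, A a -> B b ->
    `|a - c| <= eta -> `|b - c| <= eta ->
    prox_normal_cone (aff (A `|` B)) A a u ->
    prox_normal_cone (aff (A `|` B)) B b v ->
    `|u| = 1 -> `|v| = 1 -> eta <= `|u + v|.
Proof.
move=> Ac CQ; set L := aff (A `|` B).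
have AL : A `<=` L by move=> x Ax; apply: sub_aff; left.
have [U LU] := direction_of_aff _ _ (AL _ Ac).
apply: contrapT => noeta.
pose bad (eta : R) (w : X * X * (X * X)) := [/\ A w.1.1 /\ B w.1.2,
  `|w.1.1 - c| <= eta /\ `|w.1.2 - c| <= eta,
  prox_normal_cone L A w.1.1 w.2.1 /\ prox_normal_cone L B w.1.2 w.2.2,
  `|w.2.1| = 1 & `|w.2.1 + w.2.2| < eta].
have /choice[w wP] : forall k : nat, exists w, bad k.+1%:R^-1 w.
  move=> k; apply: contrapT => nobad; apply: noeta; exists k.+1%:R^-1.
    by rewrite invr_gt0 ltr0n/= invf_le1 ?ler1n ?ltr0n.
  move=> a b u v Aa Bb ac bc Nu Nv u1 v1; rewrite leNgt; apply/negP => uv.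
  by apply: nobad; exists ((a, b), (u, v)).
have [|p [pU _] clp] := compact_cluster_seq (compact_vspace_ball U 1)
    (u := fun k => (w k).2.1).
  move=> k; have [[Aa _] _ [Nu _] u1 _] := wP k.
  by split; [exact: (prox_normal_direction _ _ _ _ _ LU AL Aa)|rewrite u1].
(* Indices along which the normals converge to [p] at a harmonic rate. *)
have /choice[f fP] : forall k, exists n, (k <= n)%N /\
    `|(w n).2.1 - p| < k.+1%:R^-1.
  move=> k; have [|n kn un] := clp k.+1%:R^-1 k; last by exists n.
  by rewrite invr_gt0.
have ff k : (f k).+1%:R^-1 <= k.+1%:R^-1 :> R.
  by rewrite lef_pV2 ?posrE// ler_nat ltnS; case: (fP k).
have LT E x : prox_normal_cone L E x `<=` prox_normal_cone setT E x.
  exact: prox_normal_coneS.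
have pA : mordukhovich_normal_cone A c p.
  exists (fun k => (w (f k)).1.1), (fun k => (w (f k)).2.1); split.
  - by move=> k; have [[]] := wP (f k).
  - by move=> k; apply: LT; have [_ _ []] := wP (f k).
  - apply: (cvg_harmonic_bound ltr01) => k; rewrite mul1r.
    by have [_ [ac _] _ _ _] := wP (f k); exact: le_trans (ff k).
  - apply: (cvg_harmonic_bound ltr01) => k; rewrite mul1r ltW//.
    by case: (fP k).
have pB : mordukhovich_normal_cone B c (- p).
  exists (fun k => (w (f k)).1.2), (fun k => (w (f k)).2.2); split.
  - by move=> k; have [[]] := wP (f k).
  - by move=> k; apply: LT; have [_ _ []] := wP (f k).
  - apply: (cvg_harmonic_bound ltr01) => k; rewrite mul1r.
    by have [_ [_ bc] _ _ _] := wP (f k); exact: le_trans (ff k).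
  - have M0 : 0 < 2 :> R by [].
    apply: (cvg_harmonic_bound M0) => k; rewrite opprK.
    have [_ _ _ _ /ltW uv] := wP (f k); have [_ /ltW up] := fP k.
    set u := (w (f k)).2.1 in uv up *; set v := (w (f k)).2.2 in uv *.
    rewrite (_ : v + p = (u + v) - (u - p)); last first.
      by rewrite opprB [RHS]addrC addrA subrK addrC.
    apply: le_trans (ler_normB _ _) _; rewrite mulr_natl mulr2n lerD//.
    exact: le_trans (ff k).
have : p = 0.
  suff : [set (0 : X)] p by [].
  rewrite -CQ; split; first split => //.
    by exists (- p); rewrite ?opprK.
  by exists (c + p); [exact/LU|rewrite addrC addKr].
(* Unit vectors come within distance less than 1 of [p], so [p] is not [0]. *)
move=> p0; have [n _] := clp 1 0%N ltr01; rewrite p0 subr0.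
by have [_ _ _ -> _] := wP n; rewrite ltxx.
Qed.

End Transversality.

(** * Inner product estimates *)

Section InnerProduct.
Context {R : realType} {X : finNormedModType R} {dot : {dot X for idfun}}.
Hypothesis dot_norm : induces_norm dot.
Implicit Types (u v w a b : X).

Lemma dot_sqr u : dot u u = `|u| ^+ 2.
Proof.
rewrite dot_norm sqr_sqrtr//; have [->|u0] := eqVneq u 0.
  by rewrite linear0r.
by apply: ltW; exact: neq0_dnorm_gt0.
Qed.

Lemma sqr_normD u v : `|u + v| ^+ 2 = `|u| ^+ 2 + `|v| ^+ 2 + dot u v *+ 2.
Proof. by rewrite -!dot_sqr hnormD expr0 mul1r. Qed.

(** For unit vectors, [`|u + v|^2 = 2 + 2 * dot u v], so a lower bound on the
    norm of the sum is an upper bound on the cosine of the angle between [u] and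
    [- v]. *)
Lemma dotN_le_of_unit_sum (eta : R) u v : 0 <= eta ->
  (u != 0 -> v != 0 -> eta <= `| `|u|^-1 *: u + `|v|^-1 *: v|) ->
  dot u (- v) <= (1 - eta ^+ 2 / 2) * (`|u| * `|v|).
Proof.
move=> eta0; have [->|u0] := eqVneq u 0.
  by rewrite linear0l normr0 mul0r mulr0.
have [->|v0] := eqVneq v 0.
  by rewrite oppr0 linear0r normr0 !mulr0.
move=> /(_ isT isT) etale.
rewrite -{1}(normalizedK u u0) -{1}(normalizedK v v0) -scalerN.
set u' := _^-1 *: u in etale *; set v' := _^-1 *: v in etale *.
rewrite linearZl_LR linearZr_LR/= linearNr mulrA mulrC.
rewrite ler_pM2r ?mulr_gt0 ?normr_gt0//.
have := lerXn2r 2 eta0 (normr_ge0 _) etale.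
rewrite sqr_normD !norm_normalized//; lra.
Qed.

(** With [a'] a projection of [b]: expand [`|b - a'|^2] along
    [b - a' = (b - a) + (a - a')]. The first summand is controlled by the angle
    between normals of the two sets, the second by superregularity, where
    [`|a - a'| <= 2 * `|b - a|]. *)
Lemma contraction_step (theta eps : R) b a a' : 0 <= theta -> 0 <= eps ->
  dot (b - a') (b - a) <= theta * (`|b - a'| * `|b - a|) ->
  dot (b - a') (a - a') <= eps * `|b - a'| * `|a - a'| ->
  `|b - a'| <= `|b - a| ->
  `|b - a'| <= (theta + 2 * eps) * `|b - a|.
Proof.
move=> theta0 eps0 ang reg near.
have [->|nz] := eqVneq `|b - a'| 0.
  by rewrite mulr_ge0// addr_ge0// mulr_ge0.
have pos : 0 < `|b - a'| by rewrite lt_def nz normr_ge0.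
have tri : `|a - a'| <= 2 * `|b - a|.
  rewrite mulr_natl mulr2n; apply: le_trans (ler_distD b _ _) _.
  by rewrite distrC lerD2l.
rewrite -(ler_pM2l pos) -expr2 -dot_sqr.
rewrite (_ : dot _ _ = dot (b - a') (b - a) + dot (b - a') (a - a')).
  apply: le_trans (lerD ang reg) _.
  have := ler_wpM2l (mulr_ge0 eps0 (ltW pos)) tri; lra.
by rewrite -linearDr addrA subrK.
Qed.

End InnerProduct.

(** * Alternating projections *)

(** The quantity [`|a n - c| + 2 / (1 - kappa) * `|b n - a n|] does not increase:
    a step moves the point of [A] by at most twice the gap [d], while the gap
    loses the factor [kappa], and
    [2 * d + 2 / (1 - kappa) * (kappa * d) = 2 / (1 - kappa) * d]. Its bound by
    [rho] keeps all the points in the region where the local contraction [step]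
    applies, and the condition on [r] gives that bound for [n = 0]. *)
Lemma alternating_projections_contract {R : realType} {X : finNormedModType R}
    {A B : set X} {c b0 : X} {a b : nat -> X} {kappa rho r : R} :
  0 <= kappa < 1 -> A c -> B c -> 2 * r + 4 * r / (1 - kappa) <= rho ->
  `|b0 - c| <= r -> alternating_projections A B b0 a b ->
  (forall n, `|a n.+1 - c| <= rho -> `|b n - c| <= rho -> `|a n - c| <= rho ->
    `|b n - a n.+1| <= kappa * `|b n - a n|) ->
  forall n, `|b n - a n| <= `|b 0%N - a 0%N| * kappa ^+ n.
Proof.
move=> /andP[k0 k1] Ac Bc rrho b0c abP step.
have k1' : 0 < 1 - kappa by rewrite subr_gt0.
have inv0 : 0 <= 2 / (1 - kappa) by rewrite divr_ge0// ltW.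
have inv1 : 2 / (1 - kappa) = 2 + 2 / (1 - kappa) * kappa.
  by field; rewrite gt_eqF.
have ba n : `|b n - a n.+1| <= `|b n - a n|.
  by apply: (proj_dist _ _ _ _ (abP n.+1).1); case: (abP n) => -[].
have db n : `|b n.+1 - a n.+1| <= `|b n - a n.+1|.
  rewrite !(distrC _ (a n.+1)).
  by apply: (proj_dist _ _ _ _ (abP n.+1).2); case: (abP n) => _ [].
have move_a n : `|a n.+1 - c| <= `|a n - c| + 2 * `|b n - a n|.
  have := ler_distD (a n) (a n.+1) c; have := ler_distD (b n) (a n.+1) (a n).
  have := ba n; rewrite (distrC (a n.+1) (b n)); lra.
have key n : `|a n - c| + 2 / (1 - kappa) * `|b n - a n| <= rho /\
    `|b n - a n| <= `|b 0%N - a 0%N| * kappa ^+ n.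
  elim: n => [|n [IHr IHk]].
    rewrite expr0 mulr1; split=> //.
    have a0c : `|a 0%N - c| <= 2 * r.
      have := proj_dist _ _ _ _ (abP 0%N).1 Ac.
      have := ler_distD b0 (a 0%N) c; rewrite (distrC (a 0%N) b0); lra.
    have b0a : `|b 0%N - a 0%N| <= 2 * r.
      by rewrite distrC; exact: le_trans (proj_dist _ _ _ _ (abP 0%N).2 Bc) a0c.
    apply: le_trans rrho; apply: lerD => //.
    apply: le_trans (ler_wpM2l inv0 b0a) _.
    by rewrite le_eqVlt; apply/orP; left; apply/eqP; field; rewrite gt_eqF.
  have d0 : 0 <= `|b n - a n| by exact: normr_ge0.
  have kd0 : 0 <= 2 / (1 - kappa) * kappa * `|b n - a n|.
    by rewrite mulr_ge0// mulr_ge0.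
  rewrite inv1 mulrDl in IHr.
  have st : `|b n - a n.+1| <= kappa * `|b n - a n|.
    apply: step; [have := move_a n; lra| |lra].
    have := ler_distD (a n) (b n) c; lra.
  have stk := le_trans (db n) st.
  split.
    have := ler_wpM2l inv0 stk; have := move_a n; lra.
  apply: le_trans stk _; rewrite exprSr mulrC mulrA.
  by rewrite ler_wpM2r.
by move=> n; case: (key n).
Qed.

Theorem theorem10p20 (R : realType) (X : finNormedModType R)
  (dot : {dot X for idfun}) (dot_norm : induces_norm dot)
  (A B : set X) (A0 : A !=set0) (B0 : B !=set0)
  (clA : closed A) (clB : closed B) (c : X) (cAB : (A `&` B) c)
  (regA : superregular dot (aff (A `|` B)) A c)
  (regB : superregular dot (aff (A `|` B)) B c)
  (CQ : mordukhovich_normal_cone A c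
          `&` [set - u | u in mordukhovich_normal_cone B c]
          `&` [set z - c | z in aff (A `|` B)] = [set 0]) :
  exists2 r : R, 0 < r &
    forall b0 : X, `|b0 - c| <= r ->
    forall a b : nat -> X, alternating_projections A B b0 a b ->
    exists2 x : X, (A `&` B) x &
      converges_linearly a x /\ converges_linearly b x.
Proof.
have [Ac Bc] := cAB; set L := aff (A `|` B).
have AL : A `<=` L by move=> x Ax; apply: sub_aff; left.
have BL : B `<=` L by move=> x Bx; apply: sub_aff; right.
have [eta /andP[eta0 eta1] transv] := normals_uniformly_transversal _ _ _ Ac CQ.
have eta20 : 0 < eta ^+ 2 by rewrite exprn_gt0.
have eta21 : eta ^+ 2 <= 1 by rewrite exprn_ile1// ltW.
(* Superregularity with [eta^2 / 8] costs [eta^2 / 4], half of the gain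
   [eta^2 / 2] that transversality yields; the factor [kappa] is what remains. *)
have eps0 : 0 < eta ^+ 2 / 8 by rewrite divr_gt0.
have [delta delta0 reg] := regA _ eps0.
pose kappa := 1 - eta ^+ 2 / 4.
have kappa01 : 0 <= kappa < 1 by rewrite /kappa; apply/andP; split; lra.
have k1' : 0 < 1 - kappa by rewrite subr_gt0; case/andP: kappa01.
pose rho := Num.min eta delta.
have rho0 : 0 < rho by rewrite lt_min eta0.
exists (rho * (1 - kappa) / 6); first by rewrite divr_gt0// mulr_gt0.
move=> b0 b0c a b abP.
have Aa n : A (a n) by case: (abP n) => -[].
have Bb n : B (b n) by case: (abP n) => _ [].
have rrho : 2 * (rho * (1 - kappa) / 6) + 4 * (rho * (1 - kappa) / 6) / (1 - kappa)
    <= rho.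
  have -> : 4 * (rho * (1 - kappa) / 6) / (1 - kappa) = rho * (2 / 3).
    by field; rewrite gt_eqF.
  have : 0 <= rho * kappa by rewrite mulr_ge0//; [exact: ltW|case/andP: kappa01].
  lra.
have dk : forall n, `|b n - a n| <= `|b 0%N - a 0%N| * kappa ^+ n.
  apply: (alternating_projections_contract kappa01 Ac Bc rrho b0c abP) => n.
  rewrite /rho !le_min => /andP[a'e a'd] /andP[be bd] /andP[_ ad].
  have prA : Defs.proj A (b n) (a n.+1) by case: (abP n.+1).
  have prB : Defs.proj B (a n) (b n) by case: (abP n).
  have Nu := prox_normal_proj _ _ _ _ (BL _ (Bb n)) prA.
  have Nv := prox_normal_proj _ _ _ _ (AL _ (Aa n)) prB.
  rewrite (_ : kappa = 1 - eta ^+ 2 / 2 + 2 * (eta ^+ 2 / 8)); last first.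
    by rewrite /kappa; field.
  apply: (contraction_step dot_norm); [lra|exact: ltW| | |].
  - rewrite -(opprB (a n) (b n)) normrN.
    apply: (dotN_le_of_unit_sum dot_norm _ _ _ (ltW eta0)) => u0 v0.
    apply: (transv (a n.+1) (b n)) => //;
      try exact: norm_normalized; apply: cone_scale => //; exact: normr_ge0.
  - exact: reg.
  - exact: (proj_dist _ _ _ _ prA (Aa n)).
have [k0 k1] := andP kappa01.
pose d0 := `|b 0%N - a 0%N|.
have d0_ge0 : 0 <= d0 by exact: normr_ge0.
have step n : `|a n.+1 - a n| <= 2 * d0 * kappa ^+ n.
  have := proj_dist _ _ _ _ (abP n.+1).1 (Aa n).
  have := ler_distD (b n) (a n.+1) (a n); rewrite (distrC (a n.+1) (b n)).
  have := dk n; rewrite -/d0 -mulrA; lra.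
have [|x ax] := geometric_steps_converge _ kappa01 step; first by rewrite mulr_ge0.
set C := 2 * d0 / (1 - kappa) in ax.
have C0 : 0 <= C by rewrite divr_ge0 ?mulr_ge0// ltW.
have lina : converges_linearly a x by exists kappa, C; split.
have linb : converges_linearly b x.
  exists kappa, (d0 + C); split => // [|n]; first exact: addr_ge0.
  rewrite mulrDl; apply: le_trans (ler_distD (a n) _ _) _; exact: lerD.
exists x => //; split.
- apply: (closed_cvg A clA _ x (converges_linearly_cvg lina)).
  by exists 0%N => // n _; exact: Aa.
- apply: (closed_cvg B clB _ x (converges_linearly_cvg linb)).
  by exists 0%N => // n _; exact: Bb.
Qed.
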